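(* There are absolute constants $c,C>0$ such that the following holds. Let $A\in\mathbb{R}^{n\times d}$, $b\in\mathbb{R}^n$, and let $k\ge1$ satisfy $k\le\mathrm{rank}(A)$ and $\sigma_k>\sigma_{k+1}$, where $\sigma_i=\sigma_i(A)$. Suppose that $R\in\mathbb{R}^{d\times s}$ with $s\ge k$, and $\nu\in(0,1)$. Suppose that the matrix $T$ (with $n$ columns) provides a $c\nu$-distortion subspace embedding for $\mathrm{range}([\,U_{AR,k}\ \ U_{A,k}\ \ b\,])$, that is, $$(1-c\nu)\|v\|_2^2\le\|Tv\|_2^2\le(1+c\nu)\|v\|_2^2\quad\text{for every } v=U_{AR,k}x_1+U_{A,k}x_2+b\,x_3,\ x_1,x_2\in\mathbb{R}^k,\ x_3\in\mathbb{R}.$$ Then: 1. If $\mathrm{rank}(AR)\ge k$ and $d_2(U_{AR,k},U_{A,k})\le\nu$, then $A\tilde x_{R,k}$ is a $(C\nu,C\nu)$-approximate PCP of rank $k$. 2. If $s=k$, $R$ has orthonormal columns (i.e. $R^{T}R=I_k$) and $d_2(R,V_{A,k})\le\nu(1+\nu^2)^{-1/2}$, then $\tilde x_R$ is a $(C\nu,\,C\nu/\sigma_k)$-approximate PCR of rank $k$. Moreover, for $\delta\in(0,1)$ the subspace embedding condition on $T$ is met with probability at least $1-\delta$ if, for example, $T$ is a CountSketch matrix (independent of $A,R,b$) with $O(k^2/(\nu^2\delta))$ rows, i.e. a number of rows equal to a sufficiently large absolute constant times $k^2/(\nu^2\delta)$.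
   Context: $\|\cdot\|_2$ is the Euclidean/spectral norm. For $X\in\mathbb{R}^{m\times n}$, $X=U_X\Sigma_XV_X^{T}$ denotes a thin SVD with singular values $\sigma_1(X)\ge\sigma_2(X)\ge\dots$; $U_{X,k},V_{X,k}$ are the first $k$ columns of $U_X,V_X$, and $U_{X,k+},V_{X,k+}$ the last $\min(m,n)-k$ columns; statements are meant for any such decomposition. $X^{+}$ is the Moore–Penrose pseudo-inverse. $d_2(U,W)=\|P_U-P_W\|_2$, with $P_X$ the orthogonal projection onto the column space of $X$. $x_k=\arg\min_{x\in\mathrm{range}(V_{A,k})}\|Ax-b\|_2$ and $b_k=Ax_k$. A vector $\tilde x\in\mathbb{R}^d$ is an $(\epsilon,\upsilon)$-approximate PCR of rank $k$ if $\big|\,\|A\tilde x-b\|_2-\|Ax_k-b\|_2\big|\le\epsilon\|b\|_2$ and $\|V_{A,k+}^{T}\tilde x\|_2\le\upsilon\|b\|_2$. A vector $\tilde b\in\mathbb{R}^n$ is an $(\epsilon,\upsilon)$-approximate PCP of rank $k$ if $\big|\,\|\tilde b-b\|_2-\|b_k-b\|_2\big|\le\epsilon\|b\|_2$ and $\|U_{A,k+}^{T}\tilde b\|_2\le\upsilon\|b\|_2$. The sketched solution is $\tilde x_{R,k}=RV_{AR,k}(TARV_{AR,k})^{+}Tb$; when $R$ has exactly $k$ columns it equals $\tilde x_R=R(TAR)^{+}Tb$. A CountSketch matrix is a random matrix whose columns are independent, each being a uniformly random standard basis vector multiplied by an independent uniform random sign. *)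

(* Defs.v *)
From HB Require Import structures.
From mathcomp Require Export all_boot all_order all_algebra.
From mathcomp Require Export all_classical all_reals all_analysis.

Set Implicit Arguments.
Unset Strict Implicit.
Unset Printing Implicit Defensive.

Export Order.TTheory GRing.Theory Num.Theory.

#[export] Set Implicit Arguments.
#[export] Unset Strict Implicit.
#[export] Unset Printing Implicit Defensive.

Local Open Scope classical_set_scope.
Local Open Scope ring_scope.

Section LinearAlgebra.
Context {K : realType}.

(* Euclidean norm; the norm [`|v|] on matrices is the max norm. *)
Definition norm2 n (v : 'cV[K]_n) : K := Num.sqrt (\sum_i v i 0 ^+ 2).

Definition spectral_norm m n (M : 'M[K]_(m, n)) : K :=
  sup [set norm2 (M *m x) | x in [set x : 'cV[K]_n | norm2 x <= 1]].

Definition col_range m p (X : 'M[K]_(m, p)) : set 'cV[K]_m :=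
  [set X *m y | y in [set: 'cV[K]_p]].

(* [proj_mx] acts on row vectors, hence the transpositions; the row space of
   [kermx X] is the orthogonal complement of the column space of [X]. *)
Definition orth_proj m p (X : 'M[K]_(m, p)) : 'M[K]_m :=
  (proj_mx <<X^T>>%MS (kermx X))^T.

Definition d2 m p q (U : 'M[K]_(m, p)) (W : 'M[K]_(m, q)) : K :=
  spectral_norm (orth_proj U - orth_proj W).

(* [pinvmx] is only some partial inverse. The four Penrose equations have a
   unique solution over the reals, so the default 0 of [pinv] is never used. *)
Definition is_moore_penrose m n (X : 'M[K]_(m, n)) (Y : 'M[K]_(n, m)) : Prop :=
  [/\ X *m Y *m X = X, Y *m X *m Y = Y,
      (X *m Y)^T = X *m Y & (Y *m X)^T = Y *m X].

Definition pinv m n (X : 'M[K]_(m, n)) : 'M[K]_(n, m) :=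
  xget 0 [set Y | is_moore_penrose X Y].

Definition thin_svd m n (X : 'M[K]_(m, n)) (U : 'M[K]_(m, minn m n))
    (S : 'rV[K]_(minn m n)) (V : 'M[K]_(n, minn m n)) : Prop :=
  [/\ U^T *m U = 1%:M, V^T *m V = 1%:M, (forall i, 0 <= S 0 i),
      (forall i j : 'I_(minn m n), (i <= j)%N -> S 0 j <= S 0 i)
    & X = U *m diag_mx S *m V^T].

(* Column [j] of [X], counted from 0, and the zero column beyond the last. *)
Definition nth_col m p (X : 'M[K]_(m, p)) (j : nat) : 'cV[K]_m :=
  oapp (fun j' : 'I_p => col j' X) 0 (insub j).

Definition first_cols k m p (X : 'M[K]_(m, p)) : 'M[K]_(m, k) :=
  \matrix_(i < m, j < k) nth_col X j i 0.

Definition last_cols k m p (X : 'M[K]_(m, p)) : 'M[K]_(m, p - k) :=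
  \matrix_(i < m, j < p - k) nth_col X (k + j) i 0.

(* [sing S i] is sigma_i, numbered from 1; in particular sigma_(p+1) is 0. *)
Definition sing p (S : 'rV[K]_p) (i : nat) : K := nth_col S i.-1 0 0.

End LinearAlgebra.

Section PrincipalComponentRegression.
Context {K : realType} {n d : nat}.
Variables (A : 'M[K]_(n, d)) (b : 'cV[K]_n) (k : nat).

(* The minimizer exists, and is unique when sigma_k(A) > 0. *)
Definition pcr_sol p (V : 'M[K]_(d, p)) : 'cV[K]_d :=
  xget 0 [set x | col_range (first_cols k V) x /\
    forall y, col_range (first_cols k V) y ->
      norm2 (A *m x - b) <= norm2 (A *m y - b)].

Definition approx_pcr p (V : 'M[K]_(d, p)) (eps ups : K) (x : 'cV[K]_d) : Prop :=
  `| norm2 (A *m x - b) - norm2 (A *m pcr_sol V - b) | <= eps * norm2 b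
  /\ norm2 ((last_cols k V)^T *m x) <= ups * norm2 b.

Definition approx_pcp p (U : 'M[K]_(n, p)) (V : 'M[K]_(d, p)) (eps ups : K)
    (b' : 'cV[K]_n) : Prop :=
  `| norm2 (b' - b) - norm2 (A *m pcr_sol V - b) | <= eps * norm2 b
  /\ norm2 ((last_cols k U)^T *m b') <= ups * norm2 b.

Definition sketched_sol_rank m s (T : 'M[K]_(m, n)) (R : 'M[K]_(d, s)) p
    (VAR : 'M[K]_(s, p)) : 'cV[K]_d :=
  let Vk := first_cols k VAR in
  R *m Vk *m pinv (T *m A *m R *m Vk) *m T *m b.

Definition sketched_sol m s (T : 'M[K]_(m, n)) (R : 'M[K]_(d, s)) : 'cV[K]_d :=
  R *m pinv (T *m A *m R) *m T *m b.

End PrincipalComponentRegression.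

Definition subspace_embedding {K : realType} m n p (eps : K)
    (T : 'M[K]_(m, n)) (W : 'M[K]_(n, p)) : Prop :=
  forall v, col_range W v ->
    (1 - eps) * norm2 v ^+ 2 <= norm2 (T *m v) ^+ 2 <= (1 + eps) * norm2 v ^+ 2.

(* [h j] and [e j] are uniform and independent of each other, and the columns
   are mutually independent. Column [j] of [T w] is the basis vector [h j w] with sign [(-1) ^+ e j w].
   The columns take finitely many values, on measurable fibres, so every set
   occurring in the independence clause is an event. *)
Definition countsketch {K : realType} {disp : measure_display}
    {Om : measurableType disp} (P : probability Om K) m n
    (T : Om -> 'M[K]_(m, n)) : Prop :=
  exists (h : 'I_n -> Om -> 'I_m) (e : 'I_n -> Om -> bool),
  [/\ forall j w, col j (T w) = (-1) ^+ e j w *: delta_mx (h j w) 0,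
      forall j i s, measurable [set w | h j w = i] /\
                    measurable [set w | e j w = s],
      forall j i s, [/\ P [set w | h j w = i] = (m%:R^-1)%:E,
        P [set w | e j w = s] = (2%:R^-1)%:E
      & P [set w | h j w = i /\ e j w = s] =
        (P [set w | h j w = i] * P [set w | e j w = s])%E]
    & forall (J : {set 'I_n}) (B : 'I_n -> set 'cV[K]_m),
        P [set w | forall j, j \in J -> B j (col j (T w))] =
        (\prod_(j in J) P [set w | B j (col j (T w))])%E].

(* Main.v *)
Require Import Defs.
From mathcomp Require Import all_boot all_order all_algebra.
From mathcomp Require Import all_classical all_reals all_analysis.
From mathcomp Require Import ring lra.

(** Write [Uk], [Vk], [Q] for the leading [k] left and right singular vectors of
    [A] and the leading [k] left singular vectors of [A R]. By [pcr_solE] the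
    exact prediction [A *m pcr_sol] is the orthogonal projection [Uk Uk^T b].

    The sketched prediction lies in the range of [Q] and solves the sketched
    normal equations there. An embedding of distortion [e] changes inner
    products of vectors of its range by at most [e] times the product of their
    norms ([embedding_dot]), and the residual [b - Q Q^T b] is orthogonal to the
    range of [Q]; hence the sketched prediction is within [2 e norm2 b] of [Q
    Q^T b] ([sketched_projection_close]). It remains to compare [Q Q^T b] with
    [Uk Uk^T b]. In the first part the assumption on [d2] does it directly. In
    the second part the assumption bounds the tangent of the angle between
    [range R] and [range Vk] by [nu] ([tan_of_d2]); [A] does not increase this
    tangent, as it stretches the leading directions by at least [sigma_k] and
    the others by at most [sigma_k] ([tan_mulmx]); and a tangent bound between
    subspaces of equal dimension bounds the distance of the projections
    ([proj_dist_of_tan]).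

    For CountSketch, the law of [T] is that of [sketch_mx f] for [f] uniform
    over the finite set of assignments of a row and a sign to each column
    ([countsketch_uniform]), so probabilities become counts. The off-diagonal
    entries of [T^T T] are uncorrelated up to symmetry, because flipping one
    sign negates any other product of two of them ([cross_uncorrelated]), and
    each has variance [1 / m] ([collision_count]). Thus the squared Frobenius
    norm of [Q^T (T^T T - 1) Q], for [Q] now an orthonormal basis of dimension
    [r] of a space containing the range to be embedded, has mean at most [2
    r^2 / m]. This norm dominates the distortion ([embedding_of_err]), and
    Markov's inequality ends the proof ([countsketch_embedding]). *)

Local Open Scope classical_set_scope.
Local Open Scope ring_scope.

(** * Euclidean geometry of column vectors *)

Section Euclidean.
Context {K : realType}.

Definition dot n (u v : 'cV[K]_n) : K := \sum_i u i 0 * v i 0.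

Lemma mx11_dot n (u v : 'cV[K]_n) : (u^T *m v) 0 0 = dot u v.
Proof. by rewrite mxE; apply: eq_bigr => i _; rewrite mxE. Qed.

Lemma dotC n (u v : 'cV[K]_n) : dot u v = dot v u.
Proof. by apply: eq_bigr => i _; rewrite mulrC. Qed.

Lemma dotDl n (u v w : 'cV[K]_n) : dot (u + v) w = dot u w + dot v w.
Proof. by rewrite -big_split; apply: eq_bigr => i _; rewrite mxE mulrDl. Qed.

Lemma dotZl n a (u v : 'cV[K]_n) : dot (a *: u) v = a * dot u v.
Proof. by rewrite mulr_sumr; apply: eq_bigr => i _; rewrite mxE mulrA. Qed.

Lemma dotDr n (u v w : 'cV[K]_n) : dot w (u + v) = dot w u + dot w v.
Proof. by rewrite !(dotC w) dotDl. Qed.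

Lemma dotZr n a (u v : 'cV[K]_n) : dot u (a *: v) = a * dot u v.
Proof. by rewrite !(dotC u) dotZl. Qed.

Lemma dotNr n (u v : 'cV[K]_n) : dot u (- v) = - dot u v.
Proof. by rewrite -scaleN1r dotZr mulN1r. Qed.

Lemma dotBl n (u v w : 'cV[K]_n) : dot (u - v) w = dot u w - dot v w.
Proof. by rewrite -scaleN1r dotDl dotZl mulN1r. Qed.

Lemma dotBr n (u v w : 'cV[K]_n) : dot w (u - v) = dot w u - dot w v.
Proof. by rewrite dotDr dotNr. Qed.

Lemma dot0r n (u : 'cV[K]_n) : dot u 0 = 0.
Proof. by rewrite -(scale0r 0) dotZr mul0r. Qed.

Lemma dot_mulmxl m n (M : 'M[K]_(m, n)) u v : dot (M *m u) v = dot u (M^T *m v).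
Proof. by rewrite -!mx11_dot trmx_mul mulmxA. Qed.

Lemma dotvv_ge0 n (v : 'cV[K]_n) : 0 <= dot v v.
Proof. by apply: sumr_ge0 => i _; rewrite -expr2 sqr_ge0. Qed.

Lemma norm2_ge0 n (v : 'cV[K]_n) : 0 <= norm2 v.
Proof. exact: sqrtr_ge0. Qed.

Lemma norm2_sqr n (v : 'cV[K]_n) : norm2 v ^+ 2 = dot v v.
Proof.
rewrite sqr_sqrtr; first by apply: eq_bigr => i _; rewrite expr2.
by apply: sumr_ge0 => i _; rewrite sqr_ge0.
Qed.

Lemma norm2_eq0 n (v : 'cV[K]_n) : norm2 v = 0 -> v = 0.
Proof.
move=> v0; have := norm2_sqr v; rewrite v0 expr0n /= => /esym/eqP.
rewrite psumr_eq0 => [/allP h|i _]; last by rewrite -expr2 sqr_ge0.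
apply/matrixP=> i j; rewrite ord1 mxE; apply/eqP.
by have := h i; rewrite mem_index_enum mulf_eq0 orbb => /(_ isT).
Qed.

Lemma norm2_0 n : norm2 (0 : 'cV[K]_n) = 0.
Proof. by apply/eqP; rewrite -sqrf_eq0 norm2_sqr dot0r. Qed.

Lemma norm2Z n a (v : 'cV[K]_n) : norm2 (a *: v) = `|a| * norm2 v.
Proof.
apply/eqP; rewrite -(@eqrXn2 _ 2) ?mulr_ge0 ?norm2_ge0 //.
by rewrite exprMn !norm2_sqr real_normK ?num_real // dotZl dotZr mulrA.
Qed.

Lemma norm2N n (v : 'cV[K]_n) : norm2 (- v) = norm2 v.
Proof. by rewrite -scaleN1r norm2Z normrN1 mul1r. Qed.

Lemma norm2B n (u v : 'cV[K]_n) : norm2 (u - v) = norm2 (v - u).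
Proof. by rewrite -norm2N opprB. Qed.

Lemma le_norm2 m n (u : 'cV[K]_m) (v : 'cV[K]_n) a :
  0 <= a -> dot u u <= a ^+ 2 * dot v v -> norm2 u <= a * norm2 v.
Proof.
move=> a0; rewrite -!norm2_sqr -exprMn ler_sqr // nnegrE ?norm2_ge0 //.
by rewrite mulr_ge0 ?norm2_ge0.
Qed.

Lemma cauchy_schwarz_sqr n (u v : 'cV[K]_n) :
  dot u v ^+ 2 <= dot u u * dot v v.
Proof.
have [v0|vn0] := eqVneq (norm2 v) 0.
  by rewrite (norm2_eq0 v0) !dot0r mulr0 expr0n.
have vv0 : 0 < dot v v by rewrite -norm2_sqr exprn_even_gt0.
have := dotvv_ge0 (dot v v *: u - dot u v *: v).
rewrite !(dotBl, dotBr, dotZl, dotZr) (dotC v u).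
rewrite (_ : _ - _ = dot v v * (dot u u * dot v v - dot u v ^+ 2)); last first.
  by ring.
by rewrite pmulr_rge0 // subr_ge0.
Qed.

Lemma cauchy_schwarz n (u v : 'cV[K]_n) : `|dot u v| <= norm2 u * norm2 v.
Proof.
rewrite -ler_sqr ?nnegrE ?mulr_ge0 ?norm2_ge0 // real_normK ?num_real //.
by rewrite exprMn !norm2_sqr cauchy_schwarz_sqr.
Qed.

Lemma ler_norm2D n (u v : 'cV[K]_n) : norm2 (u + v) <= norm2 u + norm2 v.
Proof.
rewrite -ler_sqr ?nnegrE ?addr_ge0 ?norm2_ge0 // norm2_sqr dotDl !dotDr.
have := ler_norm (dot u v); have := cauchy_schwarz u v.
rewrite (dotC v u) sqrrD !norm2_sqr => h1 h2.
by have := le_trans h2 h1; lra.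
Qed.

Lemma ler_dist_norm2 n (u v : 'cV[K]_n) : `|norm2 u - norm2 v| <= norm2 (u - v).
Proof.
have h1 := ler_norm2D (u - v) v; rewrite subrK in h1.
have h2 := ler_norm2D (v - u) u; rewrite subrK norm2B in h2.
by rewrite ler_norml; apply/andP; split; lra.
Qed.

(** Cauchy-Schwarz, one row of [M] at a time, bounds [norm2 (M *m x)] by the
    Frobenius norm of [M]: the supremum defining [spectral_norm] is over a
    bounded set. *)
Lemma norm2_mulmx_frob m n (M : 'M[K]_(m, n)) x :
  norm2 (M *m x) <= Num.sqrt (\sum_i \sum_j M i j ^+ 2) * norm2 x.
Proof.
apply: le_norm2; first exact: sqrtr_ge0.
rewrite sqr_sqrtr; last by do 2![apply: sumr_ge0 => ? _]; rewrite sqr_ge0.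
rewrite mulr_suml; apply: ler_sum => i _.
have -> : (M *m x) i 0 = dot (row i M)^T x.
  by rewrite mxE; apply: eq_bigr => j _; rewrite !mxE.
rewrite -expr2; apply: le_trans (cauchy_schwarz_sqr _ _) _.
rewrite ler_wpM2r ?dotvv_ge0 // le_eqVlt; apply/orP; left; apply/eqP.
by apply: eq_bigr => j _; rewrite !mxE -expr2.
Qed.

Lemma norm2_mulmx_spectral m n (M : 'M[K]_(m, n)) x :
  norm2 (M *m x) <= spectral_norm M * norm2 x.
Proof.
have [x0|xn0] := eqVneq (norm2 x) 0.
  by rewrite (norm2_eq0 x0) mulmx0 norm2_0 norm2_0 mulr0.
have xp : 0 < norm2 x by rewrite lt_neqAle eq_sym xn0 norm2_ge0.
rewrite -ler_pdivrMr //.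
have -> : norm2 (M *m x) / norm2 x = norm2 (M *m ((norm2 x)^-1 *: x)).
  by rewrite -scalemxAr norm2Z ger0_norm ?invr_ge0 ?norm2_ge0 // mulrC.
apply: sup_upper_bound; last first.
  exists ((norm2 x)^-1 *: x) => //=.
  by rewrite norm2Z ger0_norm ?invr_ge0 ?norm2_ge0 // mulVf.
split; first by exists (norm2 (M *m 0)); exists 0 => //=; rewrite norm2_0.
exists (Num.sqrt (\sum_i \sum_j M i j ^+ 2)) => _ [y /= y1 <-].
by apply: le_trans (norm2_mulmx_frob M y) _; rewrite ler_piMr ?sqrtr_ge0.
Qed.

End Euclidean.

Section OrthonormalColumns.
Context {K : realType} {n p : nat} (Q : 'M[K]_(n, p)).
Hypothesis QTQ : Q^T *m Q = 1%:M.

(** [proj_mx] is determined by its values on the row space of [Q^T] and on the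
    kernel; [Q Q^T] and [1 - Q Q^T] split the identity accordingly. *)
Lemma orth_proj_orthonormal : orth_proj Q = Q *m Q^T.
Proof.
have cap0 : (<<Q^T>> :&: kermx Q = 0)%MS.
  apply/eqP/rowV0P => v; rewrite sub_capmx genmxE.
  case/andP=> /submxP[y ->] /sub_kermxP; rewrite -mulmxA QTQ mulmx1 => ->.
  by rewrite mul0mx.
have inQ : (Q *m Q^T <= <<Q^T>>)%MS by rewrite genmxE submxMl.
have inker : (1%:M - Q *m Q^T <= kermx Q)%MS.
  by apply/sub_kermxP; rewrite mulmxBl mul1mx -mulmxA QTQ mulmx1 subrr.
have := mulmxDl (Q *m Q^T) (1%:M - Q *m Q^T) (proj_mx <<Q^T>>%MS (kermx Q)).
rewrite (proj_mx_id cap0 inQ) (proj_mx_0 cap0 inker) addr0 addrC subrK mul1mx.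
by rewrite /orth_proj => ->; rewrite trmx_mul trmxK.
Qed.

Lemma dot_orthonormal u v : dot (Q *m u) (Q *m v) = dot u v.
Proof. by rewrite dot_mulmxl mulmxA QTQ mul1mx. Qed.

Lemma norm2_orthonormal u : norm2 (Q *m u) = norm2 u.
Proof.
apply/eqP; rewrite -(@eqrXn2 _ 2) ?norm2_ge0 //.
by rewrite !norm2_sqr dot_orthonormal.
Qed.

Lemma proj_residual_orth u v : dot (Q *m u) (v - Q *m Q^T *m v) = 0.
Proof.
by rewrite dot_mulmxl mulmxBr -mulmxA !mulmxA QTQ mul1mx subrr dot0r.
Qed.

Lemma pythagoras v :
  dot v v = dot (Q^T *m v) (Q^T *m v)
            + dot (v - Q *m Q^T *m v) (v - Q *m Q^T *m v).
Proof.
rewrite -dot_orthonormal mulmxA.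
have := proj_residual_orth (Q^T *m v) v; rewrite mulmxA.
set p1 := Q *m Q^T *m v; set p2 := v - p1 => h.
have -> : v = p2 + p1 by rewrite subrK.
by clearbody p2 p1; rewrite dotDl !dotDr h (dotC p2 p1) h; ring.
Qed.

Lemma norm2_tr_orthonormal v : norm2 (Q^T *m v) <= norm2 v.
Proof.
rewrite -[leRHS]mul1r; apply: le_norm2; first exact: ler01.
by rewrite (pythagoras v) expr1n mul1r lerDl dotvv_ge0.
Qed.

Lemma norm2_residual v : norm2 (v - Q *m Q^T *m v) <= norm2 v.
Proof.
rewrite -[leRHS]mul1r; apply: le_norm2; first exact: ler01.
by rewrite (pythagoras v) expr1n mul1r lerDr dotvv_ge0.
Qed.

(** The residual at the projection is orthogonal to the range, so any other
    point of the range is farther from [b] by a right triangle. *)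
Lemma proj_nearest u b :
  dot (Q *m u - b) (Q *m u - b)
    = dot (Q *m u - Q *m Q^T *m b) (Q *m u - Q *m Q^T *m b)
      + dot (Q *m Q^T *m b - b) (Q *m Q^T *m b - b).
Proof.
have : dot (Q *m u - Q *m Q^T *m b) (Q *m Q^T *m b - b) = 0.
  rewrite -[X in _ - X]mulmxA -mulmxBr -[X in dot _ X]opprB dotNr.
  by rewrite proj_residual_orth oppr0.
have -> : Q *m u - b = (Q *m u - Q *m Q^T *m b) + (Q *m Q^T *m b - b).
  by rewrite addrA subrK.
move: (Q *m u - _) (_ - b) => p1 p2 h.
by rewrite dotDl !dotDr h dotC h; ring.
Qed.

End OrthonormalColumns.

(** * Leading and trailing columns of a thin SVD *)

Section ColumnSplit.
Context {K : realType}.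

Definition shift_ord k p (kp : (k <= p)%N) (j : 'I_(p - k)) : 'I_p :=
  cast_ord (subnKC kp) (rshift k j).

Lemma nth_colE m p (X : 'M[K]_(m, p)) (j : 'I_p) : nth_col X j = col j X.
Proof. by rewrite /nth_col valK. Qed.

Lemma first_colsE k m p (kp : (k <= p)%N) (X : 'M[K]_(m, p)) i j :
  first_cols k X i j = X i (widen_ord kp j).
Proof. by rewrite mxE (nth_colE X (widen_ord kp j)) mxE. Qed.

Lemma last_colsE k m p (kp : (k <= p)%N) (X : 'M[K]_(m, p)) i j :
  last_cols k X i j = X i (shift_ord kp j).
Proof. by rewrite mxE (nth_colE X (shift_ord kp j)) mxE. Qed.

Lemma sum_split k p (kp : (k <= p)%N) (F : 'I_p -> K) :
  \sum_i F i = \sum_j F (widen_ord kp j) + \sum_j F (shift_ord kp j).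
Proof.
rewrite (reindex (cast_ord (subnKC kp))) /=; last first.
  by exists (cast_ord (esym (subnKC kp))) => i _; apply: val_inj.
rewrite big_split_ord /=; congr (_ + _); apply: eq_bigr => i _; congr F.
exact: val_inj.
Qed.

Lemma mulmx_split_cols k m n p (kp : (k <= p)%N)
    (X : 'M[K]_(m, p)) (Y : 'M[K]_(n, p)) :
  X *m Y^T = first_cols k X *m (first_cols k Y)^T
             + last_cols k X *m (last_cols k Y)^T.
Proof.
apply/matrixP => i j; rewrite !mxE (sum_split kp).
congr (_ + _); apply: eq_bigr => l _.
  by rewrite !mxE !(nth_colE _ (widen_ord kp l)) !mxE.
by rewrite !mxE !(nth_colE _ (shift_ord kp l)) !mxE.
Qed.

Section Orthonormal.
Context {k m p : nat} (X : 'M[K]_(m, p)).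
Hypotheses (kp : (k <= p)%N) (XTX : X^T *m X = 1%:M).

Let gram i j : \sum_l X l i * X l j = (i == j)%:R.
Proof.
have /matrixP/(_ i j) := XTX; rewrite !mxE => <-.
by apply: eq_bigr => l _; rewrite mxE.
Qed.

Lemma first_cols_orthonormal : (first_cols k X)^T *m first_cols k X = 1%:M.
Proof.
apply/matrixP => i j; rewrite !mxE.
under eq_bigr do rewrite mxE !(first_colsE kp).
by rewrite gram.
Qed.

Lemma last_cols_orthonormal : (last_cols k X)^T *m last_cols k X = 1%:M.
Proof.
apply/matrixP => i j; rewrite !mxE.
under eq_bigr do rewrite mxE !(last_colsE kp).
by rewrite gram -!val_eqE /= eqn_add2l.
Qed.

Lemma last_first_cols_orth : (last_cols k X)^T *m first_cols k X = 0.
Proof.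
apply/matrixP => i j; rewrite !mxE.
under eq_bigr do rewrite mxE (last_colsE kp) (first_colsE kp).
rewrite gram -val_eqE /=; case: eqP => // /eqP.
by rewrite gtn_eqF // (leq_trans (ltn_ord j)) ?leq_addr.
Qed.

End Orthonormal.

End ColumnSplit.

Section ThinSVD.
Context {K : realType} {n d : nat} {A : 'M[K]_(n, d)}.
Context {U : 'M[K]_(n, minn n d)} {S : 'rV[K]_(minn n d)}.
Context {V : 'M[K]_(d, minn n d)}.
Hypothesis svd : thin_svd A U S V.
Context {k : nat}.
Hypotheses (k_gt0 : (1 <= k)%N) (k_min : (k <= minn n d)%N).

Lemma svd_trU : U^T *m A = diag_mx S *m V^T.
Proof. by case: svd => UU _ _ _ ->; rewrite !mulmxA UU mul1mx. Qed.

Lemma svd_left_proj : U *m U^T *m A = A.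
Proof. by case: svd => _ _ _ _ eA; rewrite -mulmxA svd_trU mulmxA -eA. Qed.


Lemma svd_first_tr j (jp : (j <= minn n d)%N) :
  (first_cols j U)^T *m A
    = diag_mx (\row_i S 0 (widen_ord jp i)) *m (first_cols j V)^T.
Proof.
apply/matrixP => i l; rewrite mul_diag_mx !mxE.
have /matrixP/(_ (widen_ord jp i) l) := svd_trU.
rewrite mul_diag_mx !mxE (nth_colE V (widen_ord jp i)) mxE => <-.
by apply: eq_bigr => a _; rewrite ![_^T _ _]mxE (first_colsE jp).
Qed.

Lemma svd_last_tr j (jp : (j <= minn n d)%N) :
  (last_cols j U)^T *m A
    = diag_mx (\row_i S 0 (shift_ord jp i)) *m (last_cols j V)^T.
Proof.
apply/matrixP => i l; rewrite mul_diag_mx !mxE.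
have /matrixP/(_ (shift_ord jp i) l) := svd_trU.
rewrite mul_diag_mx !mxE (nth_colE V (shift_ord jp i)) mxE => <-.
by apply: eq_bigr => a _; rewrite ![_^T _ _]mxE (last_colsE jp).
Qed.

Lemma svd_mul_first :
  A *m first_cols k V
    = first_cols k U *m diag_mx (\row_i S 0 (widen_ord k_min i)).
Proof.
case: svd => _ VV _ _ _; rewrite -{1}svd_left_proj.
rewrite (mulmx_split_cols k_min) !mulmxDl -!mulmxA !(mulmxA _^T A).
rewrite svd_first_tr svd_last_tr -!mulmxA first_cols_orthonormal //.
by rewrite last_first_cols_orth // !mulmx0 addr0 mulmx1.
Qed.

Lemma sing_le_tail (i : 'I_(minn n d)) : (k.-1 <= i)%N -> S 0 i <= sing S k.
Proof.
case: svd => _ _ _ Sdec _ ki.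
have kp : (k.-1 < minn n d)%N by rewrite prednK.
by rewrite /sing (nth_colE S (Ordinal kp)) mxE Sdec.
Qed.

Lemma sing_ge_head (i : 'I_(minn n d)) : (i < k)%N -> sing S k <= S 0 i.
Proof.
case: svd => _ _ _ Sdec _ ki.
have kp : (k.-1 < minn n d)%N by rewrite prednK.
by rewrite /sing (nth_colE S (Ordinal kp)) mxE Sdec //= -ltnS prednK.
Qed.

Hypothesis k_rank : (k <= \rank A)%N.

(** Were [sigma_k] zero, [A] would factor through the first [k - 1] left
    singular vectors and have rank below [k]. *)
Lemma sing_gt0 : 0 < sing S k.
Proof.
have [_ _ S0 _ _] := svd.
have kp : (k.-1 <= minn n d)%N by rewrite (leq_trans (leq_pred k)).
rewrite ltNge; apply/negP => sk0.
have /eqP : (last_cols k.-1 U)^T *m A = 0.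
  apply/eqP; rewrite (svd_last_tr kp) (_ : \row_i _ = 0) ?linear0 ?mul0mx //.
  apply/matrixP => i j; rewrite !mxE; apply/le_anti/andP; split => //.
  by apply: le_trans sk0; apply: sing_le_tail; rewrite /= leq_addr.
move/eqP => tail0.
have := k_rank; rewrite -svd_left_proj (mulmx_split_cols kp) mulmxDl -!mulmxA.
rewrite tail0 mulmx0 addr0 => /leq_trans/(_ (mxrankM_maxl _ _)).
move=> /leq_trans/(_ (rank_leq_col _)).
by rewrite -[X in (X <= _)%N](prednK k_gt0) ltnn.
Qed.

Lemma diag_sing_unit : diag_mx (\row_i S 0 (widen_ord k_min i)) \in unitmx.
Proof.
rewrite unitmxE det_diag unitfE; apply/prodf_neq0 => i _.
rewrite mxE gt_eqF // (lt_le_trans sing_gt0) // sing_ge_head //=.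
Qed.

(** [A] maps the range of [Vk] onto that of [Uk], so the constrained least
    squares problem is projection onto the range of [Uk]. Only the image
    [A *m pcr_sol] is identified: it is the nearest point to [b], hence the same
    for every minimizer. *)
Lemma pcr_solE b :
  A *m pcr_sol A b k V = first_cols k U *m (first_cols k U)^T *m b.
Proof.
have [UU _ _ _ _] := svd.
have UkUk := first_cols_orthonormal k_min UU.
have inUk y : col_range (first_cols k V) y ->
    exists w, A *m y = first_cols k U *m w.
  by case=> w _ <-; eexists; rewrite mulmxA svd_mul_first -mulmxA.
set Uk := first_cols k U in UkUk inUk *.
set D := diag_mx (\row_i S 0 (widen_ord k_min i)).
have : exists x, [set x | col_range (first_cols k V) x /\
    forall y, col_range (first_cols k V) y ->
      norm2 (A *m x - b) <= norm2 (A *m y - b)] x.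
  exists (first_cols k V *m (invmx D *m (Uk^T *m b))); split.
    by exists (invmx D *m (Uk^T *m b)).
  move=> y /inUk[w ->].
  rewrite mulmxA svd_mul_first -mulmxA mulKVmx ?diag_sing_unit // mulmxA.
  rewrite -[leRHS]mul1r; apply: le_norm2 => //.
  by rewrite expr1n mul1r (proj_nearest UkUk w b) lerDr dotvv_ge0.
move/(xgetPex 0); rewrite -/(pcr_sol A b k V) => -[/inUk[w xw]].
move=> /(_ (first_cols k V *m (invmx D *m (Uk^T *m b)))).
move=> /(_ (ex_intro2 _ _ _ I erefl)).
rewrite [in leRHS]mulmxA svd_mul_first -[in leRHS]mulmxA.
rewrite mulKVmx ?diag_sing_unit // xw mulmxA.
rewrite -ler_sqr ?nnegrE ?norm2_ge0 // !norm2_sqr.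
rewrite (proj_nearest UkUk w b) gerDr -norm2_sqr => h.
apply/eqP; rewrite -subr_eq0; apply/eqP/norm2_eq0/eqP.
by rewrite -sqrf_eq0 eq_le h sqr_ge0.
Qed.

End ThinSVD.

(** * Sketched least squares *)

Section FullRank.
Context {K : realType}.

Lemma unitmx_inj k (H : 'M[K]_k) :
  (forall y : 'cV_k, H *m y = 0 -> y = 0) -> H \in unitmx.
Proof.
move=> Hinj; rewrite -unitmx_tr -row_free_unit; apply: inj_row_free => v vH.
apply: trmx_inj; rewrite trmx0; apply: Hinj.
by rewrite -[H]trmxK -trmx_mul vH trmx0.
Qed.

(** For [X] of full column rank the Penrose equations are solved by
    [(X^T X)^-1 X^T], so [pinv] satisfies them; the equations [X Y X = X] and
    [(X Y)^T = X Y] alone say that [X *m pinv X *m c] solves the normal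
    equations. *)
Lemma pinv_normal_eq m k (X : 'M[K]_(m, k)) (c : 'cV[K]_m) :
  (forall y : 'cV_k, X *m y = 0 -> y = 0) ->
  X^T *m (X *m Defs.pinv X *m c - c) = 0.
Proof.
move=> Xinj; have XX : X^T *m X \in unitmx.
  apply: unitmx_inj => y XXy; apply/Xinj/norm2_eq0/eqP.
  by rewrite -sqrf_eq0 norm2_sqr dot_mulmxl mulmxA XXy dot0r.
have : exists Y, [set Y | is_moore_penrose X Y] Y.
  exists (invmx (X^T *m X) *m X^T); split.
  - by rewrite -!mulmxA mulVmx // mulmx1.
  - by rewrite -(mulmxA _ X^T X) mulVmx // mul1mx.
  - by rewrite !trmx_mul trmxK trmx_inv trmx_mul trmxK mulmxA.
  - by rewrite -(mulmxA _ X^T X) mulVmx // trmx1.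
move/(xgetPex 0); rewrite -/(Defs.pinv X) => -[XYX _ XYT _].
rewrite mulmxBr mulmxA -XYT -trmx_mul XYX.
by rewrite subrr.
Qed.

End FullRank.

Section SketchedProjection.
Context {K : realType} {m n p : nat}.
Context {e : K} {T : 'M[K]_(m, n)} {W : 'M[K]_(n, p)}.
Hypothesis emb : subspace_embedding e T W.

Lemma col_rangeD u v : col_range W u -> col_range W v -> col_range W (u + v).
Proof. by move=> [x _ <-] [y _ <-]; exists (x + y); rewrite ?mulmxDr. Qed.

Lemma col_rangeZ a u : col_range W u -> col_range W (a *: u).
Proof. by move=> [x _ <-]; exists (a *: x); rewrite ?scalemxAr. Qed.

Lemma col_rangeB u v : col_range W u -> col_range W v -> col_range W (u - v).
Proof. by move=> Wu Wv; rewrite -scaleN1r; apply/col_rangeD/col_rangeZ. Qed.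

(** Polarization bounds the error in the inner product by
    [e * (|u|^2 + |v|^2) / 2]; rescaling [u] and [v] to a common norm turns the
    arithmetic mean into the product. *)
Lemma embedding_dot u v : col_range W u -> col_range W v ->
  `|dot (T *m u) (T *m v) - dot u v| <= e * (norm2 u * norm2 v).
Proof.
have polar x y : col_range W x -> col_range W y ->
    `|dot (T *m x) (T *m y) - dot x y| <= e * ((dot x x + dot y y) / 2).
  move=> Wx Wy.
  have := emb (col_rangeD Wx Wy); have := emb (col_rangeB Wx Wy).
  rewrite !norm2_sqr mulmxBr mulmxDr !(dotBl, dotBr, dotDl, dotDr).
  rewrite (dotC y x) (dotC (T *m y) (T *m x)) => /andP[h1 h2] /andP[h3 h4].
  by rewrite ler_norml; apply/andP; split; lra.
move=> Wu Wv.
have [u0|un0] := eqVneq (norm2 u) 0.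
  rewrite (norm2_eq0 u0) mulmx0 dotC dot0r dotC dot0r subrr normr0.
  by rewrite norm2_0 mul0r mulr0.
have [v0|vn0] := eqVneq (norm2 v) 0.
  by rewrite (norm2_eq0 v0) mulmx0 !dot0r subrr normr0 norm2_0 !mulr0.
have up : 0 < norm2 u by rewrite lt_neqAle eq_sym un0 norm2_ge0.
have vp : 0 < norm2 v by rewrite lt_neqAle eq_sym vn0 norm2_ge0.
have := polar _ _ (col_rangeZ (norm2 v) Wu) (col_rangeZ (norm2 u) Wv).
rewrite -!scalemxAr !(dotZl, dotZr) -!norm2_sqr.
rewrite !(mulrA (norm2 v) (norm2 u)) -mulrBr normrM.
rewrite (ger0_norm (ltW (mulr_gt0 vp up))) => h.
rewrite -(ler_pM2l (mulr_gt0 vp up)) (le_trans h) // le_eqVlt; apply/orP; left.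
by apply/eqP; field.
Qed.

Context {k : nat} {Q : 'M[K]_(n, k)} {H : 'M[K]_k} {b : 'cV[K]_n}.
Hypotheses (QTQ : Q^T *m Q = 1%:M) (Hunit : H \in unitmx).
Hypotheses (WQ : forall y, col_range W (Q *m y)) (Wb : col_range W b).
Hypotheses (e_ge0 : 0 <= e) (e_half : e <= 1 / 2).

(** With [z] the difference of the two projections and [r = b - Q Q^T b], the
    normal equations of the sketched problem give
    [|T z|^2 = <T z, T r>]. As [z] and [r] are orthogonal, the right-hand side
    is pure embedding error. Thus [|z| <= e / (1 - e) * |b|], and the factor is
    at most [2 e] for [e <= 1 / 2]. *)
Lemma sketched_projection_close :
  norm2 (Q *m H *m Defs.pinv (T *m (Q *m H)) *m (T *m b) - Q *m Q^T *m b)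
    <= 2 * e * norm2 b.
Proof.
have embQ y : (1 - e) * norm2 (Q *m y) ^+ 2 <= norm2 (T *m (Q *m y)) ^+ 2.
  by have /andP[] := emb (WQ y).
have TMinj (y : 'cV[K]_k) : T *m (Q *m H) *m y = 0 -> y = 0.
  rewrite -2!mulmxA => TQHy; have := embQ (H *m y).
  have e1 : 0 < 1 - e by have := e_half; lra.
  rewrite TQHy norm2_0 expr0n norm2_orthonormal //= (pmulr_rle0 _ e1).
  move=> le0; suff Hy : H *m y = 0 by rewrite -(mulKmx Hunit y) Hy mulmx0.
  by apply/norm2_eq0/eqP; rewrite -sqrf_eq0 eq_le le0 sqr_ge0.
have := pinv_normal_eq (T *m b) TMinj.
rewrite -(mulmxA _ (Defs.pinv _)).
rewrite -(mulmxA (Q *m H)); move: (Defs.pinv _ *m (T *m b)) => y.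
rewrite -(mulmxA T) -mulmxBr => normal.
pose z := Q *m (H *m y - Q^T *m b).
have -> : Q *m H *m y - Q *m Q^T *m b = z by rewrite /z mulmxBr !mulmxA.
set r := b - Q *m Q^T *m b.
have Wr : col_range W r by apply: col_rangeB => //; rewrite -mulmxA; apply: WQ.
have TzTz : dot (T *m z) (T *m z) = dot (T *m z) (T *m r).
  apply/eqP; rewrite -subr_eq0 -dotBr -mulmxBr; apply/eqP.
  have -> : z - r = Q *m H *m y - b.
    by rewrite /z /r mulmxBr !mulmxA opprB addrA subrK.
  have -> : T *m z = T *m (Q *m H) *m (invmx H *m (H *m y - Q^T *m b)).
    by rewrite -!mulmxA mulKVmx.
  by rewrite dot_mulmxl normal dot0r.
have zr : dot z r = 0 by rewrite proj_residual_orth.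
have := embedding_dot (WQ _ : col_range W z) Wr; rewrite zr subr0 -TzTz.
rewrite ger0_norm ?dotvv_ge0 // -norm2_sqr => up.
have := embQ (H *m y - Q^T *m b); rewrite -/z => /le_trans/(_ up).
have zge0 := norm2_ge0 z; have rb : norm2 r <= norm2 b by exact: norm2_residual.
move: zge0; rewrite le_eqVlt => /orP[/eqP<- _|zp].
  by rewrite !mulr_ge0 ?norm2_ge0.
rewrite expr2 mulrCA (mulrCA e) ler_pM2l // => h.
have := ler_wpM2l e_ge0 rb; have := norm2_ge0 z.
have := ler_wpM2r (norm2_ge0 z) e_half.
by lra.
Qed.

End SketchedProjection.

(** * Angles between subspaces *)

Section Angles.
Context {K : realType} {n k : nat} {Q P : 'M[K]_(n, k)} {nu : K}.
Hypotheses (QTQ : Q^T *m Q = 1%:M) (PTP : P^T *m P = 1%:M).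
Hypothesis tan_le : forall y,
  norm2 (Q *m y - P *m P^T *m (Q *m y)) <= nu * norm2 (P^T *m (Q *m y)).

(** The tangent bound controls only how far range [Q] sticks out of range [P].
    Since the ranges have the same dimension and [P^T *m Q] is injective, every
    [P *m w] is the projection of some point of range [Q], and the same bound
    then holds in the other direction. *)
Lemma proj_dist_of_tan b : 0 <= nu ->
  norm2 (Q *m Q^T *m b - P *m P^T *m b) <= 2 * nu * norm2 b.
Proof.
move=> nu0.
have PQunit : P^T *m Q \in unitmx.
  apply: unitmx_inj => y; rewrite -mulmxA => PQy.
  have := tan_le y; rewrite -mulmxA PQy mulmx0 subr0 norm2_0 mulr0 => le0.
  apply: norm2_eq0; rewrite -(norm2_orthonormal QTQ); apply: le_anti.
  by rewrite le0 norm2_ge0.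
set r := b - Q *m Q^T *m b; pose w := P^T *m r.
pose y := invmx (P^T *m Q) *m w.
have PQy : P^T *m (Q *m y) = w by rewrite mulmxA mulKVmx.
have wle : norm2 w <= nu * norm2 b.
  have ww : norm2 w ^+ 2 = dot (P *m w - Q *m y) r.
    by rewrite dotBl proj_residual_orth // subr0 dot_mulmxl norm2_sqr.
  have := le_trans (ler_norm _) (cauchy_schwarz (P *m w - Q *m y) r).
  have := tan_le y; rewrite -mulmxA PQy -ww norm2B => h1 h2.
  have rb : norm2 r <= norm2 b by exact: norm2_residual.
  have h3 := ler_pM (norm2_ge0 _) (norm2_ge0 _) h1 rb.
  have := le_trans h2 h3; have := norm2_ge0 w.
  rewrite le_eqVlt => /orP[/eqP <-|wp]; first by rewrite mulr_ge0 ?norm2_ge0.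
  by rewrite expr2 (mulrC nu) -mulrA ler_pM2l.
have tb : norm2 (Q *m Q^T *m b - P *m P^T *m (Q *m Q^T *m b)) <= nu * norm2 b.
  rewrite -(mulmxA Q); apply: le_trans (tan_le _) _; rewrite ler_wpM2l //.
  apply: le_trans (norm2_tr_orthonormal PTP _) _.
  by rewrite norm2_orthonormal // norm2_tr_orthonormal.
have -> : Q *m Q^T *m b - P *m P^T *m b
    = (Q *m Q^T *m b - P *m P^T *m (Q *m Q^T *m b)) - P *m w.
  by rewrite /w (mulmxA P) /r mulmxBr opprB addrA subrK.
apply: le_trans (ler_norm2D _ _) _; rewrite norm2N norm2_orthonormal //.
by lra.
Qed.

End Angles.

(** For [x = R y] with residual [r = x - V V^T x], Pythagoras splits [|x|^2] as
    [|V^T x|^2 + |r|^2], so a bound on the sine [|r| / |x|] becomes one on the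
    tangent [|r| / |V^T x|]. *)
Lemma tan_of_d2 {K : realType} d k p (R : 'M[K]_(d, k)) (V : 'M[K]_(d, p))
    nu y :
  R^T *m R = 1%:M -> V^T *m V = 1%:M -> 0 < nu ->
  d2 R V <= nu / Num.sqrt (1 + nu ^+ 2) ->
  norm2 (R *m y - V *m V^T *m (R *m y)) <= nu * norm2 (V^T *m (R *m y)).
Proof.
move=> RR VV nu0 dle; apply: le_norm2; first exact: ltW.
set x := R *m y.
have := norm2_mulmx_spectral (orth_proj R - orth_proj V) x.
rewrite -/(d2 R V) !orth_proj_orthonormal // mulmxBl.
have -> : R *m R^T *m x = x by rewrite /x -!mulmxA (mulmxA R^T) RR mul1mx.
move/le_trans => /(_ _ (ler_wpM2r (norm2_ge0 x) dle)) sine.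
have q0 : 0 < 1 + nu ^+ 2 by rewrite ltr_wpDr ?sqr_ge0 // ltr01.
rewrite -ler_sqr ?nnegrE ?mulr_ge0 ?norm2_ge0 ?invr_ge0 ?sqrtr_ge0 ?(ltW nu0) //
  in sine.
move: sine; rewrite !exprMn exprVn !norm2_sqr sqr_sqrtr ?(ltW q0) //.
rewrite (pythagoras VV x) mulrAC ler_pdivlMr //; lra.
Qed.

Section DiagNorm.
Context {K : realType} {k : nat} {D : 'rV[K]_k} {a : K} (y : 'cV[K]_k).
Hypothesis a_ge0 : 0 <= a.

Lemma norm2_diag_le :
  (forall i, 0 <= D 0 i <= a) -> norm2 (diag_mx D *m y) <= a * norm2 y.
Proof.
move=> Da; apply: le_norm2 => //; rewrite mulr_sumr; apply: ler_sum => i _.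
rewrite mul_diag_mx mxE -!expr2 exprMn ler_wpM2r ?sqr_ge0 //.
by have /andP[D0 Di] := Da i; rewrite ler_sqr ?nnegrE.
Qed.

Lemma norm2_diag_ge :
  (forall i, a <= D 0 i) -> a * norm2 y <= norm2 (diag_mx D *m y).
Proof.
move=> Da; rewrite -ler_sqr ?nnegrE ?mulr_ge0 ?norm2_ge0 // exprMn !norm2_sqr.
rewrite mulr_sumr; apply: ler_sum => i _.
rewrite mul_diag_mx mxE -!expr2 exprMn ler_wpM2r ?sqr_ge0 //.
by rewrite ler_sqr ?nnegrE // (le_trans a_ge0).
Qed.

End DiagNorm.

Section ColRangeRowMx.
Context {K : realType} {n p q : nat} (X : 'M[K]_(n, p)) (Y : 'M[K]_(n, q)).

Lemma col_range_rowl v : col_range X v -> col_range (row_mx X Y) v.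
Proof.
by move=> [x _ <-]; exists (col_mx x 0); rewrite ?mul_row_col ?mulmx0 ?addr0.
Qed.

Lemma col_range_rowr v : col_range Y v -> col_range (row_mx X Y) v.
Proof.
by move=> [y _ <-]; exists (col_mx 0 y); rewrite ?mul_row_col ?mulmx0 ?add0r.
Qed.

End ColRangeRowMx.

(** * Approximate PCP and PCR from closeness to the projection *)

Section Approximation.
Context {K : realType} {n d k : nat} {A : 'M[K]_(n, d)} {b : 'cV[K]_n}.
Context {U : 'M[K]_(n, minn n d)} {S : 'rV[K]_(minn n d)}.
Context {V : 'M[K]_(d, minn n d)}.
Hypotheses (svd : thin_svd A U S V) (k_gt0 : (1 <= k)%N).
Hypotheses (k_min : (k <= minn n d)%N) (k_rank : (k <= \rank A)%N).
Local Notation Uk := (first_cols k U).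
Local Notation Ul := (last_cols k U).
Local Notation Vk := (first_cols k V).
Local Notation Vl := (last_cols k V).

Let UTU : U^T *m U = 1%:M. Proof. by case: svd. Qed.
Let VTV : V^T *m V = 1%:M. Proof. by case: svd. Qed.

Lemma residual_close b' eta :
  norm2 (b' - Uk *m Uk^T *m b) <= eta * norm2 b ->
  `|norm2 (b' - b) - norm2 (A *m pcr_sol A b k V - b)| <= eta * norm2 b.
Proof.
rewrite (pcr_solE svd k_gt0 k_min k_rank); apply: le_trans.
apply: le_trans (ler_dist_norm2 _ _) _.
by rewrite opprB addrA subrK.
Qed.

Lemma tail_le_residual m (X : 'M[K]_(m, minn n d)) x z : X^T *m X = 1%:M ->
  norm2 ((last_cols k X)^T *m x) <= norm2 (x - first_cols k X *m z).
Proof.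
move=> XTX; have -> : (last_cols k X)^T *m x
    = (last_cols k X)^T *m (x - first_cols k X *m z).
  by rewrite mulmxBr mulmxA last_first_cols_orth // mul0mx subr0.
exact: norm2_tr_orthonormal (last_cols_orthonormal k_min XTX) _.
Qed.

(** The projection has no component along [Ul], so that of [b'] is bounded by
    the distance to the projection. *)
Lemma approx_pcp_close b' eta :
  norm2 (b' - Uk *m Uk^T *m b) <= eta * norm2 b ->
  approx_pcp A b k U V eta eta b'.
Proof.
move=> close; split; first exact: residual_close.
by apply: le_trans close; rewrite -mulmxA; apply: tail_le_residual.
Qed.

(** [A] stretches the component along [Vk] by at least [sigma_k] and the
    complementary component by at most [sigma_k], so it does not increase the
    tangent of the angle with the leading subspace. *)
Lemma tan_mulmx x nu : 0 <= nu ->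
  norm2 (x - Vk *m Vk^T *m x) <= nu * norm2 (Vk^T *m x) ->
  norm2 (A *m x - Uk *m Uk^T *m (A *m x)) <= nu * norm2 (Uk^T *m (A *m x)).
Proof.
move=> nu0 tanx; have [_ _ S0 _ _] := svd.
have s0 := sing_gt0 svd k_gt0 k_min k_rank.
have -> : A *m x - Uk *m Uk^T *m (A *m x) = Ul *m (Ul^T *m A *m x).
  rewrite -{1}(svd_left_proj svd) (mulmx_split_cols k_min) mulmxDl mulmxDl.
  by rewrite !mulmxA addrAC subrr add0r.
rewrite norm2_orthonormal ?last_cols_orthonormal // mulmxA.
rewrite (svd_last_tr svd k_min) (svd_first_tr svd k_min) -!mulmxA.
apply: (@le_trans _ _ (sing S k * norm2 (Vl^T *m x))).
  apply: norm2_diag_le (ltW s0) _ => i; rewrite mxE S0 /=.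
  apply: (sing_le_tail svd) => //.
  exact: leq_trans (leq_pred k) (leq_addr _ _).
apply: (@le_trans _ _ (nu * (sing S k * norm2 (Vk^T *m x)))).
  rewrite mulrCA ler_wpM2l ?(ltW s0) //.
  by apply: le_trans tanx; rewrite -(mulmxA Vk); apply: tail_le_residual.
rewrite ler_wpM2l //; apply: norm2_diag_ge (ltW s0) _ => i.
by rewrite mxE (sing_ge_head svd) //=.
Qed.

Lemma sing_head_le x : sing S k * norm2 (Vk^T *m x) <= norm2 (A *m x).
Proof.
have s0 := sing_gt0 svd k_gt0 k_min k_rank.
apply: (@le_trans _ _ (norm2 (Uk^T *m (A *m x)))).
  rewrite mulmxA (svd_first_tr svd k_min) -mulmxA.
  by apply: norm2_diag_ge (ltW s0) _ => i; rewrite mxE (sing_ge_head svd) //=.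
exact: norm2_tr_orthonormal (first_cols_orthonormal k_min UTU) _.
Qed.

End Approximation.

(** * The sketched solutions *)

Lemma sketched_close {K : realType} m n k l (Q : 'M[K]_(n, k))
    (U : 'M[K]_(n, l)) (b : 'cV[K]_n) (H : 'M[K]_k) (T : 'M[K]_(m, n)) nu :
  0 < nu < 1 -> Q^T *m Q = 1%:M -> H \in unitmx ->
  subspace_embedding (1 / 2 * nu) T (row_mx (row_mx Q U) b) ->
  norm2 (Q *m H *m Defs.pinv (T *m (Q *m H)) *m (T *m b) - Q *m Q^T *m b)
    <= nu * norm2 b.
Proof.
move=> /andP[nu0 nu1] QTQ Hunit emb.
have -> : nu = 2 * (1 / 2 * nu) by field.
apply: (sketched_projection_close emb QTQ Hunit); [| |lra|lra].
- by move=> y; do 2!apply: col_range_rowl; exists y.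
- by apply: col_range_rowr; exists 1%:M; rewrite ?mulmx1.
Qed.

Section Sketch.
Context {K : realType} {n d k s : nat} {A : 'M[K]_(n, d)} {b : 'cV[K]_n}.
Context {R : 'M[K]_(d, s)} {nu : K}.
Context {UA : 'M[K]_(n, minn n d)} {SA : 'rV[K]_(minn n d)}.
Context {VA : 'M[K]_(d, minn n d)}.
Context {UAR : 'M[K]_(n, minn n s)} {SAR : 'rV[K]_(minn n s)}.
Context {VAR : 'M[K]_(s, minn n s)}.
Hypotheses (svdA : thin_svd A UA SA VA) (svdAR : thin_svd (A *m R) UAR SAR VAR).
Hypotheses (k_gt0 : (1 <= k)%N) (k_rank : (k <= \rank A)%N).
Hypothesis nu01 : 0 < nu < 1.
Context {m : nat} {T : 'M[K]_(m, n)}.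
Local Notation Q := (first_cols k UAR).
Local Notation Uk := (first_cols k UA).
Hypothesis emb :
  subspace_embedding (1 / 2 * nu) T (row_mx (row_mx Q Uk) b).

Let k_min : (k <= minn n d)%N.
Proof. by rewrite (leq_trans k_rank) // leq_min rank_leq_row rank_leq_col. Qed.

Let UTU : UA^T *m UA = 1%:M. Proof. by case: svdA. Qed.
Let VTV : VA^T *m VA = 1%:M. Proof. by case: svdA. Qed.
Let QTQ_all : UAR^T *m UAR = 1%:M. Proof. by case: svdAR. Qed.

Lemma sketched_pcp : (k <= \rank (A *m R)%R)%N -> d2 Q Uk <= nu ->
  approx_pcp A b k UA VA (3 * nu) (3 * nu)
    (A *m sketched_sol_rank A b k T R VAR).
Proof.
move=> rAR dle; have /andP[nu0 nu1] := nu01.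
have ks : (k <= minn n s)%N.
  by rewrite (leq_trans rAR) // leq_min rank_leq_row rank_leq_col.
apply: (approx_pcp_close svdA) => //.
have := sketched_close nu01 (first_cols_orthonormal ks QTQ_all)
  (diag_sing_unit svdAR k_gt0 ks rAR) emb.
rewrite -(svd_mul_first svdAR ks) /sketched_sol_rank !mulmxA => close.
have := norm2_mulmx_spectral (orth_proj Q - orth_proj Uk) b.
rewrite -/(d2 Q Uk) !orth_proj_orthonormal ?first_cols_orthonormal //.
move/le_trans => /(_ _ (ler_wpM2r (norm2_ge0 b) dle)).
rewrite mulmxBl => dist.
rewrite -[X in norm2 X](subrKA (Q *m Q^T *m b)).
apply: le_trans (ler_norm2D _ _) _.
by have := norm2_ge0 b; have := mulr_ge0 (ltW nu0) (norm2_ge0 b); lra.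
Qed.

End Sketch.

Section SketchExact.
Context {K : realType} {n d k : nat} {A : 'M[K]_(n, d)} {b : 'cV[K]_n}.
Context {R : 'M[K]_(d, k)} {nu : K}.
Context {UA : 'M[K]_(n, minn n d)} {SA : 'rV[K]_(minn n d)}.
Context {VA : 'M[K]_(d, minn n d)}.
Context {UAR : 'M[K]_(n, minn n k)} {SAR : 'rV[K]_(minn n k)}.
Context {VAR : 'M[K]_(k, minn n k)}.
Hypotheses (svdA : thin_svd A UA SA VA) (svdAR : thin_svd (A *m R) UAR SAR VAR).
Hypotheses (k_gt0 : (1 <= k)%N) (k_rank : (k <= \rank A)%N).
Hypothesis nu01 : 0 < nu < 1.
Context {m : nat} {T : 'M[K]_(m, n)}.
Local Notation Q := (first_cols k UAR).
Local Notation Uk := (first_cols k UA).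
Local Notation Vk := (first_cols k VA).
Hypothesis emb :
  subspace_embedding (1 / 2 * nu) T (row_mx (row_mx Q Uk) b).

Let k_min : (k <= minn n d)%N.
Proof. by rewrite (leq_trans k_rank) // leq_min rank_leq_row rank_leq_col. Qed.

Let k_n : (k <= minn n k)%N.
Proof. by rewrite leq_min leqnn andbT (leq_trans k_rank) ?rank_leq_row. Qed.

Let UTU : UA^T *m UA = 1%:M. Proof. by case: svdA. Qed.
Let VTV : VA^T *m VA = 1%:M. Proof. by case: svdA. Qed.
Let QTQ : Q^T *m Q = 1%:M.
Proof. by apply: first_cols_orthonormal; case: svdAR. Qed.

(** [R] has exactly [k] columns, so the [k] left singular vectors exhaust the
    range of [A R] and no truncation takes place. *)
Lemma range_AR : A *m R = Q *m (Q^T *m (A *m R)).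
Proof.
rewrite -{1}(svd_left_proj svdAR) (mulmx_split_cols k_n).
rewrite mulmxDl -!mulmxA [X in _ + X](_ : _ = 0) ?addr0 //.
apply/matrixP => i j; rewrite [LHS]mxE [RHS]mxE big1 // => l _.
(* [UAR] has [minn n k = k] columns, so none is left in [last_cols]. *)
have := ltn_ord l; rewrite ltn_subRL addnC ltnNge.
by rewrite (leq_trans (geq_minr n k)) ?leq_addl.
Qed.

(** The tangent of the angle between [range R] and [range Vk] is at most [nu],
    and [A] carries this bound over to [range (A R)] and [range Uk]; from there
    the residual is estimated as for a PCP. The tangent bound used once more,
    now on the domain side, gives the trailing component of the solution
    [x = R y]: it is at most [nu] times [norm2 (Vk^T *m x)], and
    [sigma_k * norm2 (Vk^T *m x) <= norm2 (A *m x) <= 3 * norm2 b]. *)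
Lemma sketched_pcr : R^T *m R = 1%:M ->
  d2 R Vk <= nu / Num.sqrt (1 + nu ^+ 2) ->
  approx_pcr A b k VA (3 * nu) (3 * nu / sing SA k) (sketched_sol A b T R).
Proof.
move=> RTR dle; have /andP[nu0 nu1] := nu01.
have UkTUk := first_cols_orthonormal k_min UTU.
have VkTVk := first_cols_orthonormal k_min VTV.
have s0 := sing_gt0 svdA k_gt0 k_min k_rank.
have tanR y := tan_of_d2 y RTR VkTVk nu0 dle.
have tanAR y := tan_mulmx svdA k_gt0 k_min k_rank (ltW nu0) (tanR y).
have Hunit : Q^T *m (A *m R) \in unitmx.
  apply: unitmx_inj => y QARy.
  have ARy : A *m (R *m y) = 0 by rewrite mulmxA range_AR -mulmxA QARy mulmx0.
  have := sing_head_le svdA k_gt0 k_min k_rank (R *m y).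
  rewrite ARy norm2_0 (pmulr_rle0 _ s0) => le0.
  have Vk0 : norm2 (Vk^T *m (R *m y)) = 0.
    by apply: le_anti; rewrite le0 norm2_ge0.
  have := tanR y.
  rewrite Vk0 mulr0 -[Vk *m _ *m _]mulmxA (norm2_eq0 Vk0) mulmx0 subr0.
  rewrite norm2_orthonormal // => y0.
  by apply: norm2_eq0; apply: le_anti; rewrite y0 norm2_ge0.
have := range_AR; move: (Q^T *m (A *m R)) Hunit => H Hunit eAR.
have tanQ y : norm2 (Q *m y - Uk *m Uk^T *m (Q *m y))
    <= nu * norm2 (Uk^T *m (Q *m y)).
  have -> : Q *m y = A *m (R *m (invmx H *m y)).
    by rewrite (mulmxA A) eAR -mulmxA mulKVmx.
  exact: tanAR.
have dist := proj_dist_of_tan QTQ UkTUk tanQ b (ltW nu0).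
have close : norm2 (A *m sketched_sol A b T R - Q *m Q^T *m b) <= nu * norm2 b.
  have := sketched_close nu01 QTQ Hunit emb.
  by rewrite -eAR /sketched_sol !mulmxA.
have b0 := norm2_ge0 b; have nub0 := mulr_ge0 (ltW nu0) b0.
split.
  apply: residual_close svdA k_gt0 k_min k_rank _ _ _.
  rewrite -[X in norm2 X](subrKA (Q *m Q^T *m b)).
  by apply: le_trans (ler_norm2D _ _) _; lra.
rewrite /sketched_sol -!mulmxA in close *.
move: (Defs.pinv _ *m _) close => y close.
apply: le_trans (tail_le_residual k_min _ (Vk^T *m (R *m y)) VTV) _.
rewrite (mulmxA Vk); apply: le_trans (tanR y) _.
have bt : norm2 (A *m (R *m y)) <= 3 * norm2 b.
  rewrite -[X in norm2 X](subrK (Q *m (Q^T *m b))).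
  apply: le_trans (ler_norm2D _ _) _.
  rewrite [in X in _ + X]norm2_orthonormal //.
  have := norm2_tr_orthonormal QTQ b; have := ler_wpM2r b0 (ltW nu1).
  by lra.
rewrite (mulrAC (3 * nu)) ler_pdivlMr // (mulrC 3) -!mulrA ler_pM2l //.
rewrite mulrC; apply: le_trans bt.
exact: sing_head_le svdA k_gt0 k_min k_rank _.
Qed.

End SketchExact.

(** * Second moment of the CountSketch embedding error *)

Section HashingModel.
Context {K : realType} {m n : nat}.
Local Notation cfg := {ffun 'I_n -> 'I_m * bool}.

Definition sketch_mx (f : cfg) : 'M[K]_(m, n) :=
  \matrix_(i, j) ((-1) ^+ (f j).2 * (i == (f j).1)%:R).

Definition embed_err (f : cfg) (u v : 'cV[K]_n) : K :=
  dot (sketch_mx f *m u) (sketch_mx f *m v) - dot u v.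

(** Entry [p] of [T^T *m T - 1] for [T = sketch_mx f]. *)
Definition cross (f : cfg) (p : 'I_n * 'I_n) : K :=
  (p.1 != p.2)%:R * ((-1) ^+ (f p.1).2 * (-1) ^+ (f p.2).2
                     * ((f p.1).1 == (f p.2).1)%:R).

Lemma embed_errE f u v :
  embed_err f u v = \sum_p cross f p * (u p.1 0 * v p.2 0).
Proof.
have gram j l : \sum_i sketch_mx f i j * sketch_mx f i l
    = cross f (j, l) + (j == l)%:R.
  rewrite (bigD1 (f j).1) //= big1 => [|i ij]; last first.
    by rewrite !mxE (negPf ij) mulr0 mul0r.
  rewrite !mxE eqxx /cross /= addr0 mulr1; case: (eqVneq j l) => [->|_] /=.
    by rewrite eqxx mulr1 mul0r add0r -expr2 sqrr_sign.
  by rewrite mul1r addr0 mulrA.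
rewrite /embed_err.
have -> : dot u v = \sum_j \sum_l (j == l)%:R * (u j 0 * v l 0).
  apply: eq_bigr => j _.
  rewrite (bigD1 j) //= eqxx mul1r big1 ?addr0 // => l lj.
  by rewrite eq_sym (negPf lj) mul0r.
rewrite -(pair_bigA _ (fun j l => cross f (j, l) * (u j 0 * v l 0))) /=.
apply/eqP; rewrite subr_eq; apply/eqP; rewrite -big_split /=.
under [RHS]eq_bigr do rewrite -big_split /=.
have -> : dot (sketch_mx f *m u) (sketch_mx f *m v) = \sum_j \sum_l \sum_i
    (sketch_mx f i j * u j 0) * (sketch_mx f i l * v l 0).
  under [RHS]eq_bigr do rewrite exchange_big.
  rewrite [RHS]exchange_big; apply: eq_bigr => i _; rewrite 2!mxE mulr_suml.
  by apply: eq_bigr => j _; rewrite mulr_sumr.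
apply: eq_bigr => j _; apply: eq_bigr => l _; rewrite -mulrDl -gram mulr_suml.
by apply: eq_bigr => i _; ring.
Qed.

Definition update (j : 'I_n) (g : 'I_m * bool -> 'I_m * bool) (f : cfg) : cfg :=
  [ffun a => if a == j then g (f a) else f a].

Lemma sum_update j g (F : cfg -> K) : injective g ->
  \sum_f F (update j g f) = \sum_f F f.
Proof.
move=> ginj; rewrite [RHS](reindex_inj (h := update j g)) // => f f' /ffunP ff'.
by apply/ffunP => a; have := ff' a; rewrite !ffunE; case: eqP => // _ /ginj.
Qed.

Definition flip (x : 'I_m * bool) := (x.1, ~~ x.2).

Lemma sum_flip_odd j (F : cfg -> K) :
  (forall f, F (update j flip f) = - F f) -> \sum_f F f = 0.
Proof.
move=> Fodd; have flip_inj : injective flip.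
  by move=> [i x] [i' x'] [-> /negb_inj ->].
have := sum_update j F flip_inj.
under eq_bigr do rewrite Fodd.
by rewrite sumrN => h; lra.
Qed.

Lemma update_neq j g f a : a != j -> update j g f a = f a.
Proof. by move=> aj; rewrite ffunE (negPf aj). Qed.

Lemma sign_flip j f : (-1) ^+ (update j flip f j).2 = - (-1) ^+ (f j).2 :> K.
Proof. by rewrite ffunE eqxx /= signrN. Qed.

Lemma hash_flip j f a : (update j flip f a).1 = (f a).1.
Proof. by rewrite ffunE; case: eqP. Qed.

Lemma cross_diag f j : cross f (j, j) = 0.
Proof. by rewrite /cross eqxx mul0r. Qed.

Lemma cross_sym f p : cross f (p.2, p.1) = cross f p.
Proof. by rewrite /cross /= eq_sym (eq_sym (f p.1).1); ring. Qed.

Lemma cross_flip_out f j p : j != p.1 -> j != p.2 ->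
  cross (update j flip f) p = cross f p.
Proof. by move=> j1 j2; rewrite /cross !update_neq // eq_sym. Qed.

Lemma cross_flip_in f p : cross (update p.1 flip f) p = - cross f p.
Proof.
rewrite /cross !hash_flip sign_flip; case: eqVneq => [_|p12] /=.
  by rewrite !mul0r oppr0.
by rewrite update_neq 1?eq_sym //; ring.
Qed.

Lemma cross_flip_uncorrelated p q : p.1 != q.1 -> p.1 != q.2 ->
  \sum_f cross f p * cross f q = 0.
Proof.
move=> n1 n2; apply: (sum_flip_odd (j := p.1)) => f.
by rewrite cross_flip_in cross_flip_out // mulNr.
Qed.

(** Flipping the sign of a column that occurs in only one of the two pairs
    negates the product, so only identical or swapped pairs correlate. *)
Lemma cross_uncorrelated p q : q != p -> q != (p.2, p.1) ->
  \sum_f cross f p * cross f q = 0.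
Proof.
case: p q => [j l] [j' l'] /= qp qp'.
have [->|jl] := eqVneq j l.
  by rewrite big1 // => f _; rewrite cross_diag mul0r.
have [/andP[j1 j2]|] := boolP ((j != j') && (j != l')).
  exact: cross_flip_uncorrelated.
have [/andP[l1 l2] _|] := boolP ((l != j') && (l != l')).
  under eq_bigr do rewrite -(cross_sym _ (j, l)).
  exact: cross_flip_uncorrelated.
rewrite !negb_and !negbK => /orP[]/eqP el /orP[]/eqP ej; move: jl qp qp';
  by rewrite el ej eqxx.
Qed.

End HashingModel.

(** Shifting the row of column [j] cyclically by each [t] permutes the
    configurations, and exactly one [t] makes columns [j] and [l] collide. *)
Lemma collision_count (K : realType) m n (j l : 'I_n) : (0 < m)%N -> j != l ->
  m%:R * (\sum_(f : {ffun 'I_n -> 'I_m * bool}) ((f j).1 == (f l).1)%:R)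
    = #|{ffun 'I_n -> 'I_m * bool}|%:R :> K.
Proof.
case: m => // m _; rewrite eq_sym => lj.
pose shift (t : 'I_m.+1) (x : 'I_m.+1 * bool) := (x.1 + t, x.2).
have shift_inj t : injective (shift t).
  move=> [i x] [i' x'] e; have /= -> := congr1 snd e.
  by have /= /addIr -> := congr1 fst e.
rewrite mulr_natl -[in X in _ *+ X](card_ord m.+1) -sumr_const.
under eq_bigr => t _ do rewrite -(sum_update j _ (@shift_inj t)).
rewrite exchange_big -sum1_card natr_sum; apply: eq_bigr => f _.
rewrite (bigD1 ((f l).1 - (f j).1)) //= (update_neq _ _ lj) ffunE eqxx /=.
rewrite [_ + (_ - _)]addrC subrK eqxx big1 ?addr0 // => t tne.
rewrite (update_neq _ _ lj) ffunE eqxx /=.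
by rewrite addrC eq_sym -subr_eq eq_sym (negPf tne).
Qed.

Section SecondMoment.
Context {K : realType} {m n : nat}.
Hypothesis m_gt0 : (0 < m)%N.
Local Notation cfg := {ffun 'I_n -> 'I_m * bool}.
Local Notation N := (#|{ffun 'I_n -> 'I_m * bool}|%:R : K).

Lemma cross_moment p q :
  \sum_(f : cfg) cross f p * cross f q
    = (p.1 != p.2)%:R * (N / m%:R) * ((q == p)%:R + (q == (p.2, p.1))%:R).
Proof.
case: p => [j l] /=; have [->|jl] := eqVneq j l.
  by rewrite !mul0r big1 // => f _; rewrite cross_diag mul0r.
have m0 : m%:R != 0 :> K by rewrite pnatr_eq0 -lt0n.
have sq : \sum_(f : cfg) cross f (j, l) * cross f (j, l) = N / m%:R.
  rewrite -(collision_count K m_gt0 jl) mulrC mulKf //; apply: eq_bigr => f _.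
  rewrite /cross /= jl mul1r; case: eqP => _; last by rewrite !mulr0.
  by rewrite !mulr1 mulrACA -!expr2 !sqrr_sign mulr1.
have [->|qp] := eqVneq q (j, l).
  by rewrite sq mul1r xpair_eqE (negPf jl) addr0 mulr1.
have [->|qp'] := eqVneq q (l, j).
  rewrite add0r mulr1 mul1r -sq; apply: eq_bigr => f _.
  by rewrite -(cross_sym f (j, l)).
by rewrite addr0 mulr0 cross_uncorrelated.
Qed.

(** Expanding the square, only the terms at [q = p] and at [q] the swap of [p]
    survive averaging, each with weight [1 / m]; by the arithmetic-geometric
    mean inequality the swapped terms are no larger than the diagonal ones. *)
Lemma embed_err_moment (u v : 'cV[K]_n) :
  \sum_(f : cfg) embed_err f u v ^+ 2 <= 2 * (N / m%:R) * (dot u u * dot v v).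
Proof.
pose w (p : 'I_n * 'I_n) := u p.1 0 * v p.2 0.
pose swap (p : 'I_n * 'I_n) := (p.2, p.1).
have pick F (r : 'I_n * 'I_n) : \sum_q F q * (q == r)%:R = F r :> K.
  rewrite (bigD1 r) //= eqxx mulr1 big1 ?addr0 // => q qr.
  by rewrite (negPf qr) mulr0.
have -> : \sum_(f : cfg) embed_err f u v ^+ 2
    = \sum_p (p.1 != p.2)%:R * (N / m%:R) * (w p * (w p + w (swap p))).
  under eq_bigr do rewrite embed_errE expr2 big_distrlr /=.
  rewrite exchange_big; apply: eq_bigr => p _ /=.
  rewrite exchange_big /=.
  have -> : w p + w (swap p)
      = \sum_q w q * ((q == p)%:R + (q == swap p)%:R).
    by under eq_bigr do rewrite mulrDr; rewrite big_split /= !pick.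
  rewrite !mulr_sumr; apply: eq_bigr => q _ /=.
  under eq_bigr do rewrite mulrACA.
  by rewrite -mulr_suml cross_moment /w; ring.
have Nm0 : 0 <= N / m%:R by rewrite divr_ge0 ?ler0n.
pose w2 p := w p ^+ 2.
have -> : 2 * (N / m%:R) * (dot u u * dot v v)
    = \sum_p N / m%:R * (w2 p + (w2 p + w2 (swap p)) / 2).
  have sumw2 : \sum_p w2 p = dot u u * dot v v.
    rewrite big_distrlr /= (pair_bigA _ (fun j l => _ * _ * (_ * _))) /=.
    by apply: eq_bigr => p _; rewrite /w2 /w; ring.
  have sumw2' : \sum_p w2 (swap p) = dot u u * dot v v.
    rewrite -sumw2 [RHS](reindex_inj (h := swap)) //.
    by move=> [j l] [j' l'] [-> ->].
  rewrite -mulr_sumr big_split -mulr_suml big_split /= sumw2 sumw2'.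
  by move: (N / m%:R) (dot u u * dot v v) => c D; field.
apply: ler_sum => p _; rewrite mulrAC mulrC ler_wpM2l // /w2.
have := sqr_ge0 (w p - w (swap p)); have := sqr_ge0 (w p).
have := sqr_ge0 (w (swap p)); case: (p.1 != p.2) => /=; nra.
Qed.

End SecondMoment.

(** * Success probability of CountSketch *)

Lemma gram_dot {K : realType} n p q (X : 'M[K]_(n, p)) (Y : 'M[K]_(n, q)) i j :
  (X^T *m Y) i j = dot (col i X) (col j Y).
Proof. by rewrite mxE; apply: eq_bigr => l _; rewrite !mxE. Qed.

Lemma mulmx_col {K : realType} m n p (T : 'M[K]_(m, n)) (X : 'M[K]_(n, p)) j :
  T *m col j X = col j (T *m X).
Proof. by rewrite !colE mulmxA. Qed.

(** Gram-Schmidt: a column outside the range of [Q] contributes its normalized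
    residual. *)
Lemma orthonormal_span {K : realType} n p (X : 'M[K]_(n, p)) :
  exists r (Q : 'M[K]_(n, r)) (Y : 'M[K]_(r, p)),
    [/\ (r <= p)%N, Q^T *m Q = 1%:M & X = Q *m Y].
Proof.
elim: p X => [|p IH] X.
  exists 0%N, 0, 0; split=> //; last by rewrite [X]thinmx0 mulmx0.
  by rewrite [LHS]flatmx0 [RHS]flatmx0.
rewrite -[X](@hsubmxK _ n 1 p).
move: (@lsubmx _ n 1 p X) (@rsubmx _ n 1 p X) => x {}X.
have [r [Q [Y [rp QQ ->]]]] := IH X.
pose x' := x - Q *m (Q^T *m x).
have xE : x = x' + Q *m (Q^T *m x) by rewrite subrK.
have [x0|xn0] := eqVneq (norm2 x') 0.
  exists r, Q, (row_mx (Q^T *m x) Y); split; rewrite ?(leq_trans rp) //.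
  by rewrite (mul_mx_row Q (Q^T *m x) Y) [in LHS]xE (norm2_eq0 x0) add0r.
pose q := (norm2 x')^-1 *: x'.
have Qq : Q^T *m q = 0.
  by rewrite -scalemxAr mulmxBr !mulmxA QQ mul1mx subrr scaler0.
have qq : q^T *m q = 1%:M.
  apply/matrixP => i j; rewrite !ord1 mx11_dot mxE eqxx dotZl dotZr.
  by rewrite -norm2_sqr expr2 mulKf // mulVf.
exists (1 + r)%N, (row_mx q Q), (block_mx (norm2 x')%:M 0 (Q^T *m x) Y).
split=> //.
  rewrite tr_row_mx mul_col_row QQ Qq qq -[q^T *m Q]trmxK trmx_mul trmxK Qq.
  by rewrite trmx0 -scalar_mx_block.
rewrite (mul_row_block q Q (norm2 x')%:M 0 (Q^T *m x) Y) mulmx0 add0r.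
by rewrite mul_mx_scalar scalerA divff // scale1r -xE.
Qed.

Section EmbeddingProbability.
Context {K : realType} {m n : nat}.
Local Notation cfg := {ffun 'I_n -> 'I_m * bool}.
Local Notation N := (#|{ffun 'I_n -> 'I_m * bool}|%:R : K).

(** On the range of [Q] the distortion is the quadratic form of
    [(T Q)^T (T Q) - 1], whose entries are the errors on pairs of columns of
    [Q]; its Frobenius norm bounds it. *)
Lemma embedding_of_err r p (Q : 'M[K]_(n, r)) (Y : 'M[K]_(r, p)) (f : cfg)
    (e : K) :
  0 <= e -> Q^T *m Q = 1%:M ->
  \sum_i \sum_j embed_err f (col i Q) (col j Q) ^+ 2 <= e ^+ 2 ->
  subspace_embedding e (sketch_mx f) (Q *m Y).
Proof.
move=> e0 QQ err _ [x _ <-]; rewrite -(mulmxA Q); move: (Y *m x) => y.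
set T := sketch_mx f; pose B := (T *m Q)^T *m (T *m Q) - 1%:M.
have BE i j : B i j = embed_err f (col i Q) (col j Q).
  rewrite /embed_err -/T !mulmx_col.
  by rewrite -!gram_dot QQ /B !mxE.
have : `|dot y (B *m y)| <= e * dot y y.
  apply: le_trans (cauchy_schwarz _ _) _; rewrite -norm2_sqr expr2 mulrCA.
  rewrite ler_wpM2l ?norm2_ge0 //; apply: le_trans (norm2_mulmx_frob B y) _.
  rewrite ler_wpM2r ?norm2_ge0 // -(ger0_norm e0) -sqrtr_sqr.
  rewrite ler_sqrt ?sqr_ge0 //.
  by under eq_bigr do under eq_bigr do rewrite BE.
rewrite mulmxBl mul1mx dotBr -mulmxA -dot_mulmxl -(mulmxA T) !norm2_sqr.
rewrite (dot_orthonormal QQ) ler_norml => /andP[h1 h2]; apply/andP; split; lra.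
Qed.

(** Markov's inequality for the squared Frobenius norm, a sum of [r ^ 2] second
    moments, over the uniform distribution on configurations. *)
Lemma bad_count r p (Q : 'M[K]_(n, r)) (Y : 'M[K]_(r, p)) (e : K) :
  (0 < m)%N -> 0 < e -> Q^T *m Q = 1%:M ->
  #|[pred f : cfg | ~~ `[< subspace_embedding e (sketch_mx f) (Q *m Y) >]]|%:R
      * e ^+ 2
    <= 2 * r%:R ^+ 2 / m%:R * N.
Proof.
move=> m0 e0 QQ; rewrite mulr_natl -sumr_const.
pose err (f : cfg) := \sum_i \sum_j embed_err f (col i Q) (col j Q) ^+ 2.
have err0 f : 0 <= err f by do 2![apply: sumr_ge0 => ? _]; rewrite sqr_ge0.
apply: (@le_trans _ _ (\sum_f err f)).
  rewrite [leRHS](bigID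
    [pred f | ~~ `[< subspace_embedding e (sketch_mx f) (Q *m Y) >]]) /=.
  rewrite ler_wpDr ?sumr_ge0 //; apply: ler_sum => f /= /asboolPn bad.
  rewrite leNgt; apply/negP => small; apply: bad.
  by apply: embedding_of_err (ltW e0) QQ _; apply: ltW.
rewrite exchange_big /=.
have sum_const2 (c : K) : r%:R ^+ 2 * c = \sum_(i < r) \sum_(j < r) c.
  rewrite !sumr_const !card_ord -[RHS]mulr_natl -[c *+ r]mulr_natl.
  by rewrite mulrA -expr2.
have -> : 2 * r%:R ^+ 2 / m%:R * N = r%:R ^+ 2 * (2 * (N / m%:R)).
  by move: N m%:R^-1 => M c; ring.
rewrite sum_const2.
apply: ler_sum => i _; rewrite exchange_big /=; apply: ler_sum => j _.
apply: le_trans (embed_err_moment m0 _ _) _.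
have unit_col l : dot (col l Q) (col l Q) = 1.
  by rewrite -gram_dot QQ mxE eqxx.
by rewrite !unit_col !mulr1.
Qed.

Lemma col_sketch_mx_inj (f g : cfg) j :
  col j (sketch_mx f) = col j (sketch_mx g) :> 'cV[K]_m -> f j = g j.
Proof.
move=> /matrixP/(_ (f j).1 0); rewrite !mxE eqxx mulr1.
case: eqVneq => [e1|_] /=; last by rewrite mulr0 => /eqP; rewrite signr_eq0.
rewrite mulr1 => /signr_inj e2.
by rewrite [f j]surjective_pairing e1 e2 -surjective_pairing.
Qed.

Context {disp : measure_display} {Om : measurableType disp}.
Context {P : probability Om K} {T : Om -> 'M[K]_(m, n)}.

(** Only the law of the columns matters: [T] is [sketch_mx] of a uniformly
    distributed configuration. *)
Lemma countsketch_uniform : countsketch P T ->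
  exists F : Om -> cfg, [/\ forall w, T w = sketch_mx (F w),
    forall f, measurable [set w | F w = f]
    & forall f, P [set w | F w = f]
                = (N^-1)%:E].
Proof.
move=> [h [e [Tcol meas unif indep]]].
pose F w : cfg := [ffun j => (h j w, e j w)].
have TF w : T w = sketch_mx (F w).
  apply/matrixP => i j; have /matrixP/(_ i 0) := Tcol j w.
  by rewrite !mxE ffunE andbT.
have cell f : [set w | F w = f] = \bigcap_(j in [set: 'I_n])
    ([set w | h j w = (f j).1] `&` [set w | e j w = (f j).2]).
  apply/seteqP; split=> w /=.
    by move=> <- j _ /=; rewrite ffunE.
  by move=> hf; apply/ffunP => j; have [/= h1 h2] := hf j I;
    rewrite ffunE h1 h2 -surjective_pairing.
exists F; split=> // f.
  rewrite cell; apply: fin_bigcap_measurable => // j _.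
  by have [mh me] := meas j (f j).1 (f j).2; apply: measurableI.
have colE j : [set w | [set col j (sketch_mx f)] (col j (T w))]
    = [set w | h j w = (f j).1 /\ e j w = (f j).2].
  apply/seteqP; split=> w /=; rewrite TF.
    by move/col_sketch_mx_inj => <-; rewrite ffunE.
  move=> [h1 h2]; apply/matrixP => a b; rewrite !mxE.
  by rewrite ffunE h1 h2.
have -> : [set w | F w = f] = [set w | forall j, j \in [set: 'I_n]%SET ->
    [set col j (sketch_mx f)] (col j (T w))].
  apply/seteqP; split=> w /=; first by move=> <- j _; rewrite TF.
  move=> hf; apply/ffunP => j; apply: col_sketch_mx_inj.
  by rewrite -TF; apply: hf; rewrite inE.
rewrite (indep [set: 'I_n]%SET (fun j => [set col j (sketch_mx f)])).
rewrite (eq_bigr (fun=> (m%:R^-1 * 2^-1)%:E)); last first.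
  move=> j _; rewrite colE; have [-> -> ->] := unif j (f j).1 (f j).2.
  by rewrite EFinM.
rewrite -(big_morph EFin (@EFinM K) erefl) prodr_const cardsT card_ord.
by rewrite card_ffun card_prod card_bool !card_ord natrX natrM -invfM exprVn.
Qed.

Lemma countsketch_embedding p (W : 'M[K]_(n, p)) (e delta : K) :
  (0 < m)%N -> 0 < e -> 2 * p%:R ^+ 2 <= delta * e ^+ 2 * m%:R ->
  countsketch P T ->
  ((1 - delta)%:E <= P [set w | subspace_embedding e (T w) W])%E.
Proof.
move=> m0 e0 pm /countsketch_uniform[F [TF cell unif]].
have [r [Q [Y [rp QQ ->]]]] := orthonormal_span W.
pose good (f : cfg) := `[< subspace_embedding e (sketch_mx f) (Q *m Y) >].
have -> : [set w | subspace_embedding e (T w) (Q *m Y)]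
    = \bigcup_(f in [set` good]) [set w | F w = f].
  apply/seteqP; split=> w /=.
    by rewrite TF => emb; exists (F w) => //=; apply/asboolP.
  by case=> f /asboolP emb /= Ff; rewrite TF Ff.
rewrite measure_fin_bigcup //; last by move=> f g _ _ [w [/= <- <-]].
rewrite -(bigfs _ _ (r := index_enum _)) ?index_enum_uniq //; last first.
  by move=> f _; rewrite mem_index_enum.
rewrite (eq_bigr (fun=> (N^-1)%:E)); last by move=> f _; apply: unif.
rewrite sumEFin lee_fin sumr_const -[leRHS]mulr_natl.
have N0 : 0 < N.
  by rewrite card_ffun card_prod card_bool !card_ord ltr0n expn_gt0 muln_gt0 m0.
have mR : 0 < m%:R :> K by rewrite ltr0n.
have e2 : 0 < e ^+ 2 by rewrite exprn_gt0.
rewrite ler_pdivlMr //.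
have GB : #|good|%:R + #|[pred f | ~~ good f]|%:R = N.
  by rewrite -natrD; congr _%:R; apply: cardC.
suff : #|[pred f | ~~ good f]|%:R <= delta * N by move: GB; lra.
rewrite -(ler_pM2r e2); apply: le_trans (bad_count Y m0 e0 QQ) _.
rewrite [leRHS]mulrAC ler_wpM2r ?(ltW N0) // ler_pdivrMr //; apply: le_trans pm.
by rewrite ler_wpM2l // ler_sqr ?nnegrE ?ler0n // ler_nat.
Qed.

End EmbeddingProbability.

Theorem theorem18 (K : realType) :
  exists c C C0 : K,
  [/\ 0 < c, 0 < C, 0 < C0 &
  forall (n d k s : nat) (A : 'M[K]_(n, d)) (b : 'cV[K]_n)
    (R : 'M[K]_(d, s)) (nu : K)
    (UA : 'M[K]_(n, minn n d)) (SA : 'rV[K]_(minn n d))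
    (VA : 'M[K]_(d, minn n d))
    (UAR : 'M[K]_(n, minn n s)) (SAR : 'rV[K]_(minn n s))
    (VAR : 'M[K]_(s, minn n s)),
  thin_svd A UA SA VA -> thin_svd (A *m R) UAR SAR VAR ->
  (1 <= k)%N -> (k <= \rank A)%N -> sing SA k.+1 < sing SA k ->
  (k <= s)%N -> 0 < nu < 1 ->
  let W := row_mx (row_mx (first_cols k UAR) (first_cols k UA)) b in
  (forall (m : nat) (T : 'M[K]_(m, n)),
     subspace_embedding (c * nu) T W ->
     ((k <= \rank (A *m R)%R)%N ->
      d2 (first_cols k UAR) (first_cols k UA) <= nu ->
      approx_pcp A b k UA VA (C * nu) (C * nu)
        (A *m sketched_sol_rank A b k T R VAR))
     /\
     (s = k -> R^T *m R = 1%:M ->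
      d2 R (first_cols k VA) <= nu / Num.sqrt (1 + nu ^+ 2) ->
      approx_pcr A b k VA (C * nu) (C * nu / sing SA k)
        (sketched_sol A b T R)))
  /\
  (forall (delta : K) (m : nat) (disp : measure_display)
     (Om : measurableType disp) (P : probability Om K)
     (T : Om -> 'M[K]_(m, n)),
     0 < delta < 1 ->
     C0 * k%:R ^+ 2 / (nu ^+ 2 * delta) <= m%:R ->
     countsketch P T ->
     ((1 - delta)%:E <= P [set w | subspace_embedding (c * nu) (T w) W])%E)].
Proof.
(* The subspace is spanned by [2 k + 1 <= 3 k] columns and the distortion is
   [nu / 2], so the requirement [2 (2 k + 1)^2 <= delta (nu / 2)^2 m] follows
   from [72 k^2 / (nu^2 delta) <= m]. *)
exists (1 / 2), 3, 72; split; [lra|lra|lra|].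
move=> n d k s A b R nu UA SA VA UAR SAR VAR svdA svdAR k0 kA _ ks nu01 W.
split=> [m T emb|delta m disp Om P T /andP[d0 d1] mbig cs].
  split=> [rAR dle|sk].
    exact (sketched_pcp svdA svdAR k0 kA nu01 emb rAR dle).
  subst s => RTR dle.
  exact (sketched_pcr svdA svdAR k0 kA nu01 emb RTR dle).
have /andP[nu0 nu1] := nu01.
have nud : 0 < nu ^+ 2 * delta by rewrite mulr_gt0 ?exprn_gt0.
have kR : 1 <= k%:R :> K by rewrite ler1n.
rewrite ler_pdivrMr // in mbig.
have m0 : (0 < m)%N.
  rewrite -(ltr0n K) -(pmulr_lgt0 _ nud); apply: lt_le_trans mbig.
  by rewrite mulr_gt0 ?exprn_gt0 // (lt_le_trans ltr01).
apply: countsketch_embedding cs => //; first lra.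
rewrite !natrD; nra.
Qed.
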